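(* For every integer $k\ge 3$, the infinite product $D_k$ converges and $0<D_k<1$. Furthermore, for every integer $k\ge 3$ and every positive integer $n$, $\frac{1}{2k}<g_k(n)<2k$.
   Context: $p$ always denotes a prime. For positive integers $k,n$: $\delta_k(x)=\dfrac{(x-1)^{k}+k(x-1)^{k-1}+(-1)^{k}(k-1)}{x}$. $D_k=\prod_{p}\dfrac{\delta_k(p)}{p^{k-1}}$, the product being over all primes $p$. $g_k(n)=\prod_{p\mid n}\left(1+\dfrac{(-1)^{k-1}(k-1)}{\delta_k(p)}\right)$, the product being over the primes $p$ dividing $n$ (empty product equal to $1$). *)

(* Defs.v *)
From mathcomp Require Import all_boot all_order all_algebra.
From mathcomp Require Import all_classical all_reals all_analysis.

Set Implicit Arguments.
Unset Strict Implicit.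
Unset Printing Implicit Defensive.

Import Order.TTheory GRing.Theory Num.Theory.
Import numFieldNormedType.Exports.

Local Open Scope ring_scope.

Section ArithmeticFactors.
Variable R : realType.

(* The truncated subtractions below are genuine ones, as k is positive. *)
Definition delta (k : nat) (x : R) : R :=
  ((x - 1) ^+ k + k%:R * (x - 1) ^+ (k - 1) + (-1) ^+ k * (k - 1)%:R) / x.

(* The product over all primes is taken in increasing order of the primes:
   D k is the limit of the products over the primes p <= N.  The value of D k
   is meaningful only when the sequence D_partial k converges. *)
Definition D_partial (k N : nat) : R :=
  \prod_(0 <= p < N.+1 | prime p) (delta k p%:R / p%:R ^+ (k - 1)).

Definition D (k : nat) : R := limn (D_partial k).

Definition g (k n : nat) : R :=
  \prod_(p <- primes n) (1 + (-1) ^+ (k - 1) * (k - 1)%:R / delta k p%:R).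

End ArithmeticFactors.

Arguments D_partial R k N : clear implicits.
Arguments D R k : clear implicits.
Arguments g R k n : clear implicits.

(* Main.v *)
(* Put h(m) = (m-1)/(m-2).  For k >= 3 and m >= 3 the factor of g_k at m lies
   between h(m+2)/h(m) and h(m)/h(m+2), because
   2 y^(k-2) (y+k) >= (k-1) (y+1)^2 for y = m-1 >= 2.  Distinct odd primes differ
   by at least 2, so the product over the odd primes dividing n telescopes and
   lies strictly between 1/h(3) = 1/2 and h(3) = 2; the factor at 2 is k for odd k
   and 1/k for even k.  The factors of D_k lie in (0,1), and Bernoulli's
   inequality bounds them below by 1 - k(k-1)/p^2, which keeps the decreasing
   partial products away from 0. *)

Require Import Defs.
From mathcomp Require Import all_boot all_order all_algebra.
From mathcomp Require Import all_classical all_reals all_analysis.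
From mathcomp Require Import zify ring lra.

Import Order.TTheory GRing.Theory Num.Theory.
Import numFieldNormedType.Exports.

Local Open Scope ring_scope.

(** * Closed form of [delta] with k written as [j.+3], and a lower bound for it *)

Lemma deltaE (R : realType) (j : nat) (x : R) :
  delta j.+3 x =
  ((x - 1) ^+ j.+2 * (x + j.+2%:R) - (-1) ^+ j * j.+2%:R) / x.
Proof.
rewrite /delta subn1 /=; congr (_ / _).
by rewrite !exprS -!natr1; ring.
Qed.

Lemma delta2 (R : realType) (j : nat) :
  delta j.+3 (2 : R) = if odd j then j.+3%:R else 1.
Proof.
rewrite deltaE -signr_odd.
have -> : (2 - 1 : R) = 1 by ring.
by rewrite expr1n -!natr1; case: (odd j); rewrite /= ?expr1 ?expr0; field.
Qed.

(** Passing from j to j+1 multiplies the left side by (j+3)/(j+2) <= 2 <= y and the right side by at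
    least y. *)
Lemma delta_growth (R : realType) (j : nat) (y : R) : 2 <= y ->
  j.+2%:R * (y + 1) ^+ 2 <= 2 * y ^+ j.+1 * (y + j.+3%:R).
Proof.
move=> y2; elim: j => [|j IH]; first by rewrite expr1; nra.
have yj : 0 <= y ^+ j.+1 by apply: exprn_ge0; lra.
have j0 : 0 <= j%:R :> R by [].
have step : j.+3%:R * (y + 1) ^+ 2 <= y * (j.+2%:R * (y + 1) ^+ 2).
  rewrite mulrA ler_wpM2r ?sqr_ge0 // -!natr1; nra.
apply: (le_trans step).
have le1 := ler_wpM2l (_ : 0 <= y) IH.
apply: (le_trans (le1 _)); first lra.
rewrite (exprS _ j.+1) -!natr1.
have : 0 <= y * y ^+ j.+1 by apply: mulr_ge0 => //; lra.
move: IH le1 => _ _; nra.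
Qed.

(** [delta_growth] at y = x - 1, multiplied by (x-1)/2, bounds the main term of [deltaE]; the sign
    term is kept exactly. *)
Lemma delta_ge (R : realType) (j : nat) (x : R) : 3 <= x ->
  j.+2%:R * (x * (x - 1) / 2 - (-1) ^+ j / x) <= delta j.+3 x.
Proof.
move=> x3; rewrite deltaE ler_pdivlMr; last lra.
have := @delta_growth R j (x - 1); rewrite subrK => /(_ ltac:(lra)) H.
have -> : j.+2%:R * (x * (x - 1) / 2 - (-1) ^+ j / x) * x =
  j.+2%:R * x ^+ 2 * ((x - 1) / 2) - (-1) ^+ j * j.+2%:R.
  by field; lra.
rewrite lerD2r.
have x1 : 0 <= (x - 1) / 2 by lra.
apply: (le_trans (ler_wpM2r x1 H)).
by rewrite (exprS _ j.+1) -!natr1 le_eqVlt; apply/orP; left; apply/eqP; field.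
Qed.

(** * A single factor of [g], compared with quotients of h *)

Definition telescoper (R : realType) (m : nat) : R := (m%:R - 1) / (m%:R - 2).

Definition g_factor (R : realType) (k p : nat) : R :=
  1 + (-1) ^+ (k - 1) * (k - 1)%:R / delta k p%:R.

Lemma g_factor_bounds (R : realType) (j m : nat) : (3 <= m)%N ->
  telescoper R m.+2 / telescoper R m <= g_factor R j.+3 m <=
  telescoper R m / telescoper R m.+2.
Proof.
move=> m3; have x3 : 3 <= m%:R :> R by rewrite (ler_nat R 3).
rewrite /g_factor /telescoper subn1 /= -(natr1 m.+1) -(natr1 m).
set x : R := m%:R in x3 *.
have := @delta_ge R j x x3; set d := delta _ _; set a : R := j.+2%:R => H.
have a0 : 0 < a by rewrite ltr0n.
have -> : (x + 1 + 1 - 1) / (x + 1 + 1 - 2) / ((x - 1) / (x - 2)) =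
  1 - 2 / (x * (x - 1)) by field; do ?[apply/andP; split]; lra.
have -> : (x - 1) / (x - 2) / ((x + 1 + 1 - 1) / (x + 1 + 1 - 2)) =
  1 + 2 / ((x - 2) * (x + 1)) by field; do ?[apply/andP; split]; lra.
have r0 : 0 <= 2 / (x * (x - 1)) by apply: divr_ge0; nra.
have s0 : 0 <= 2 / ((x - 2) * (x + 1)) by apply: divr_ge0; nra.
have ix : x^-1 <= 1 by rewrite invf_le1; lra.
have ix0 : 0 <= x^-1 by rewrite invr_ge0; lra.
rewrite !exprS -signr_odd in H *.
(* For odd j the factor is 1 - a/d, so only the lower bound matters, and the term 1/x in [H] is
   dropped. For even j it is 1 + a/d, and 1/x <= 1 turns [H] into d >= a(x-2)(x+1)/2. *)
case: (odd j) H => /=; rewrite ?expr1 ?expr0 => H.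
- have d0 : 0 < d by apply: lt_le_trans H; apply: mulr_gt0 => //; nra.
  have dB : a * (x * (x - 1) / 2) <= d by apply: le_trans H; rewrite ler_pM2l //; lra.
  have ad0 : 0 <= a / d by apply: divr_ge0; apply: ltW.
  have ad : a / d <= 2 / (x * (x - 1)).
    rewrite ler_pdivrMr // mulrAC ler_pdivlMr; nra.
  by apply/andP; split; lra.
- have dB : a * ((x - 2) * (x + 1) / 2) <= d.
    by apply: le_trans H; rewrite ler_pM2l //; lra.
  have d0 : 0 < d by apply: lt_le_trans dB; apply: mulr_gt0 => //; nra.
  have ad0 : 0 <= a / d by apply: divr_ge0; apply: ltW.
  have ad : a / d <= 2 / ((x - 2) * (x + 1)).
    rewrite ler_pdivrMr // mulrAC ler_pdivlMr; nra.
  by apply/andP; split; lra.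
Qed.

Lemma g_factor2 (R : realType) (j : nat) :
  g_factor R j.+3 2 = if odd j then j.+3%:R^-1 else j.+3%:R.
Proof.
rewrite /g_factor delta2 subn1 /= !exprS -signr_odd.
have j0 : 0 <= j%:R :> R by [].
by case: (odd j); rewrite /= ?expr1 ?expr0 -!natr1; field; lra.
Qed.

(** * Telescoping over increasing lists of odd numbers *)

Lemma telescoper_gt1 (R : realType) (m : nat) : (3 <= m)%N -> 1 < telescoper R m.
Proof.
move=> m3; have x3 : 3 <= m%:R :> R by rewrite (ler_nat R 3).
by rewrite /telescoper ltr_pdivlMr; lra.
Qed.

Lemma telescoper_le (R : realType) (m n : nat) : (3 <= m)%N -> (m <= n)%N ->
  telescoper R n <= telescoper R m.
Proof.
move=> m3 mn; have x3 : 3 <= m%:R :> R by rewrite (ler_nat R 3).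
have xy : m%:R <= n%:R :> R by rewrite ler_nat.
rewrite /telescoper ler_pdivrMr; last lra.
rewrite mulrAC ler_pdivlMr; nra.
Qed.

(** The start m varies in the induction: after a head p the remaining entries are odd and exceed p,
    so the hypothesis applies at [p.+2] and h(p+2) cancels. Strictness comes from the empty product,
    since h > 1. *)
Lemma telescoped_prod (R : realType) (f : nat -> R) (m : nat) (s : seq nat) :
  (forall i, (3 <= i)%N -> telescoper R i.+2 / telescoper R i <= f i <=
     telescoper R i / telescoper R i.+2) ->
  (3 <= m)%N -> all odd s -> all (leq m) s -> sorted ltn s ->
  (telescoper R m)^-1 < \prod_(i <- s) f i < telescoper R m.
Proof.
move=> fP; elim: s m => [|p s IH] m m3.
  have h1 := telescoper_gt1 R m m3.
  by rewrite big_nil h1 invf_lt1 ?h1 // (lt_trans _ h1).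
rewrite [all _ _]/= => /andP[podd sodd] /= /andP[mp _] ps.
have p3 := leq_trans m3 mp.
have sp : all (leq p.+2) s.
  have := order_path_min ltn_trans ps => /allP ltp.
  apply/allP => q qs; have := ltp q qs; have := allP sodd q qs => qodd /=.
  by move: podd qodd; lia.
have /andP[lo up] := IH p.+2 (leq_trans p3 (leqW (leqnSn _))) sodd sp (path_sorted ps).
have /andP[flo fup] := fP p p3.
have h1 := telescoper_gt1 R p p3.
have h2 := telescoper_gt1 R p.+2 (leq_trans p3 (leqW (leqnSn _))).
have hm := telescoper_gt1 R m m3.
have hmp := telescoper_le R m p m3 mp.
move: (telescoper R p) (telescoper R p.+2) (telescoper R m) h1 h2 hm hmp lo up flo fup.
move=> a b c a1 b1 c1 ac lo up flo fup.
have a0 : 0 < a by lra.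
have b0 : 0 < b by lra.
have c0 : 0 < c by lra.
rewrite big_cons; move: (\prod_(_ <- _) _) (f p) lo up flo fup => P F lo up flo fup.
have bi : 0 < b^-1 by rewrite invr_gt0.
have F0 : 0 < F by apply: lt_le_trans flo; apply: divr_gt0.
apply/andP; split.
- apply: (@le_lt_trans _ _ (a^-1)); first by rewrite lef_pV2.
  apply: (@le_lt_trans _ _ (F * b^-1)); last by rewrite ltr_pM2l.
  by rewrite ler_pdivlMr // mulrC.
- apply: (@lt_le_trans _ _ (F * b)); first by rewrite ltr_pM2l.
  by apply: le_trans ac; rewrite -ler_pdivlMr.
Qed.

(** * Bounds for [g] *)

Lemma g_bounds (R : realType) (k n : nat) : (3 <= k)%N ->
  1 / (2 * k%:R) < g R k n < 2 * k%:R.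
Proof.
case: k => [|[|[|j]]] // _.
rewrite -[g _ _ _]/(\prod_(p <- primes n) g_factor R j.+3 p).
have k1 : 3 <= j.+3%:R :> R by rewrite (ler_nat R 3).
have kV1 : j.+3%:R^-1 <= 1 :> R by rewrite invf_le1; lra.
have kge1 : 1 <= j.+3%:R :> R by rewrite (ler_nat R 1).
(* Here t stands for the factor at 2, or 1 if 2 is absent, and P for the product over the odd
   primes. *)
have combine (t P : R) : j.+3%:R^-1 <= t <= j.+3%:R -> 2^-1 < P < 2 ->
    1 / (2 * j.+3%:R) < t * P < 2 * j.+3%:R.
  rewrite div1r invfM; have : 0 < j.+3%:R^-1 :> R by rewrite invr_gt0; lra.
  move: (j.+3%:R : R) (_^-1) k1 => K V K3 V0 /andP[Vt tK] /andP[P1 P2].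
  have t0 := lt_le_trans V0 Vt.
  by apply/andP; split; nra.
have h3 : telescoper R 3 = 2 by rewrite /telescoper; field; lra.
have odds s : all prime s -> all (leq 3) s -> all odd s.
  move=> /allP sp /allP s3; apply/allP => q qs.
  by have := s3 q qs; case: (even_prime (sp q qs)) => // ->.
have main s : all prime s -> all (leq 3) s -> sorted ltn s ->
    2^-1 < \prod_(p <- s) g_factor R j.+3 p < 2.
  move=> sp s3 ss; have := @telescoped_prod R (g_factor R j.+3) 3 s.
  by rewrite h3; apply => //; [exact: g_factor_bounds | exact: odds].
have sp : all prime (primes n).
  by apply/allP => q; rewrite mem_primes => /andP[].
have := sorted_primes n.
(* As [primes n] is increasing, only its head can be 2. *)
case: (primes n) sp => [|p s] sp ss.
  by have := combine 1 1; rewrite big_nil mulr1 kV1 kge1; apply => //; lra.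
have [pp sp'] := andP sp.
have := order_path_min ltn_trans ss => /allP ltp.
have [p2|p2] := eqVneq p 2%N.
  have s3 : all (leq 3) s by apply/allP => q /ltp; rewrite p2.
  rewrite big_cons p2 g_factor2; apply: combine (main s sp' s3 (path_sorted ss)).
  by case: (odd j); rewrite lexx (le_trans kV1).
have p3 : (3 <= p)%N by have := prime_gt1 pp; move: p2; lia.
have s3 : all (leq 3) (p :: s).
  by rewrite /= p3; apply/allP => q /ltp; apply: leq_trans; apply: leqW.
rewrite -[X in _ < X < _]mul1r; apply: combine (main _ sp s3 ss).
by rewrite kV1.
Qed.

(** * The factors of [D], and products of factors of this size *)

Lemma delta_gt0 (R : realType) (j p : nat) : (2 <= p)%N ->
  0 < delta j.+3 (p%:R : R).
Proof.
rewrite leq_eqVlt => /orP[/eqP <-|p3].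
  by rewrite delta2; case: (odd j); rewrite ?ltr01 ?ltr0n.
have x3 : 3 <= p%:R :> R by rewrite (ler_nat R 3).
move: (p%:R : R) x3 => x x3.
apply: lt_le_trans (delta_ge R j x x3); apply: mulr_gt0; first by rewrite ltr0n.
have ix : x^-1 <= 1 by rewrite invf_le1; lra.
have ix0 : 0 <= x^-1 by rewrite invr_ge0; lra.
rewrite -signr_odd; case: (odd j); rewrite ?expr1 ?expr0; nra.
Qed.

(** The left side consists of the terms of degrees k, k-1, 1 and 0 in the binomial expansion, where
    k = j+3. The slack ky + 1 later absorbs the sign term of [delta]. *)
Lemma exprD1_ge (R : realType) (j : nat) (y : R) : 0 <= y ->
  y ^+ j.+2 * (y + j.+3%:R) + j.+3%:R * y + 1 <= (y + 1) ^+ j.+3.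
Proof.
move=> y0; elim: j => [|j IH]; first by rewrite le_eqVlt; apply/orP; left; apply/eqP; ring.
rewrite (exprSr _ j.+3).
have y1 : 0 <= y + 1 by lra.
apply: (le_trans _ (ler_wpM2r y1 IH)).
rewrite (exprS _ j.+2) -(natr1 j.+3).
have ya : 0 <= y ^+ j.+2 by apply: exprn_ge0.
have j0 : 0 <= j.+3%:R :> R by [].
move: (y ^+ _) (j.+3%:R : R) ya j0 => A a A0 a0.
have : 0 <= A * a by apply: mulr_ge0.
have : 0 <= a * y * y by rewrite !mulr_ge0.
lra.
Qed.

Lemma D_factor_lt1 (R : realType) (j : nat) (x : R) : 2 <= x ->
  delta j.+3 x / x ^+ j.+2 < 1.
Proof.
move=> x2; have x0 : 0 < x by lra.
rewrite ltr_pdivrMr ?exprn_gt0 // mul1r deltaE ltr_pdivrMr // -exprSr.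
have := exprD1_ge R j (x - 1); rewrite subrK => /(_ ltac:(lra)).
have j0 : 0 <= j%:R :> R by [].
rewrite -signr_odd; case: (odd j); rewrite ?expr1 ?expr0 -!natr1; nra.
Qed.

(** Bernoulli's inequality (1 - 1/x)^n >= 1 - n/x, multiplied by x^(n+1). *)
Lemma bernoulli_scaled (R : realType) (n : nat) (x : R) : 1 <= x ->
  x ^+ n * (x - n%:R) <= (x - 1) ^+ n * x.
Proof.
move=> x1; elim: n => [|n IH]; first by rewrite !expr0 subr0.
have x10 : 0 <= x - 1 by lra.
have := ler_wpM2l x10 IH.
have xn : 0 <= x ^+ n by apply: exprn_ge0; lra.
have n0 : 0 <= n%:R :> R by [].
have : 0 <= x ^+ n * n%:R by apply: mulr_ge0.
rewrite !exprS -natr1; nra.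
Qed.

(** With a = j+2, Bernoulli gives (x-1)^a (x+a) x >= x^a (x^2 - a^2), and the sign term costs at
    most a x <= a x^a; together the loss is a(a+1) x^a. *)
Lemma D_factor_ge (R : realType) (j : nat) (x : R) : 2 <= x ->
  1 - j.+2%:R * j.+3%:R / x ^+ 2 <= delta j.+3 x / x ^+ j.+2.
Proof.
move=> x2; have x0 : 0 < x by lra.
have xa : 0 < x ^+ j.+2 by apply: exprn_gt0.
rewrite ler_pdivlMr // deltaE ler_pdivlMr //.
have B := bernoulli_scaled R j.+2 x ltac:(lra).
have xX : x <= x ^+ j.+2 by apply: ler_eXnr => //; lra.
have a0 : 0 <= j.+2%:R :> R by [].
have sg : (-1) ^+ j * j.+2%:R * x <= j.+2%:R * x ^+ j.+2.
  by rewrite -signr_odd; case: (odd j); rewrite ?expr1 ?expr0; nra.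
rewrite -(natr1 j.+2) -(ler_pM2r x0).
have -> : (1 - j.+2%:R * (j.+2%:R + 1) / x ^+ 2) * x ^+ j.+2 * x * x =
  x ^+ j.+2 * (x ^+ 2 - j.+2%:R * (j.+2%:R + 1)) by field; lra.
have xa2 : 0 <= x + j.+2%:R by lra.
have := ler_wpM2r xa2 B; nra.
Qed.

(* Since 1 - c / n ^+ 2 >= (1/2 + c/n) / (1/2 + c/(n-1)) for n > 2c, the quotient
   of the partial product by 1/2 + c/n is nondecreasing from n = 2c on. *)
Lemma prod_bounded_away_from0 (R : realType) (f : nat -> R) (c : nat) :
  (0 < c)%N -> (forall i, 0 < f i <= 1) ->
  (forall i, (0 < i)%N -> 1 - c%:R / i%:R ^+ 2 <= f i) ->
  exists2 l, 0 < l & forall n, l <= \prod_(0 <= i < n.+1) f i.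
Proof.
pose P n := \prod_(0 <= i < n.+1) f i; rewrite -/P.
move=> c0 f01 fc; have Pgt n : 0 < P n.
  by apply: prodr_gt0 => i _; case/andP: (f01 i).
have PS n : P n.+1 = P n * f n.+1 by rewrite /P big_nat_recr.
have c0R : 0 < c%:R :> R by rewrite ltr0n.
have tail d : P (2 * c)%N * (1 / 2 + c%:R / (2 * c + d)%:R) <= P (2 * c + d)%N.
  elim: d => [|d IH].
    rewrite addn0 natrM; have -> : 1 / 2 + c%:R / (2 * c%:R) = 1 :> R by field; lra.
    by rewrite mulr1.
  rewrite addnS PS; have := fc (2 * c + d).+1 isT.
  have m1 : 2 * c%:R <= (2 * c + d)%:R :> R by rewrite -natrM ler_nat leq_addr.
  have /andP[F0 _] := f01 (2 * c + d).+1.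
  have Q0 := Pgt (2 * c)%N.
  rewrite -natr1; move: (2 * c + d)%N m1 F0 IH => n m1 F0 IH Fc.
  apply: (le_trans _ (ler_wpM2r (ltW F0) IH)); rewrite -mulrA ler_pM2l //.
  move: (n%:R : R) (c%:R : R) (f n.+1) c0R m1 F0 Fc => x C F C0 m1 F0 Fc.
  have h0 : 0 <= 1 / 2 + C / x by apply: addr_ge0; [lra | apply: divr_ge0; lra].
  apply: (le_trans _ (ler_wpM2l h0 Fc)); rewrite -subr_ge0.
  have -> : (1 / 2 + C / x) * (1 - C / (x + 1) ^+ 2) - (1 / 2 + C / (x + 1)) =
    C * (x + 2 - 2 * C) / (2 * x * (x + 1) ^+ 2) by field; do ?[apply/andP; split]; lra.
  apply: divr_ge0; first by apply: mulr_ge0; lra.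
  by rewrite !mulr_ge0 ?sqr_ge0 //; lra.
have Pdecr m n : (m <= n)%N -> P n <= P m.
  move=> /subnK <-; elim: (n - m)%N => // d IH; apply: le_trans IH.
  by rewrite addSn PS ler_piMr ?(ltW (Pgt _)) //; case/andP: (f01 (d + m).+1) => // _.
have Q0 := Pgt (2 * c)%N.
(* In [tail] the factor 1/2 + c/n is at least 1/2. An arbitrary n is handled by comparing [P n] with
   the smaller [P (n + 2 * c)]. *)
exists (P (2 * c)%N * (1 / 2)); first by apply: mulr_gt0 => //; lra.
move=> n; have low m : (2 * c <= m)%N -> P (2 * c)%N * (1 / 2) <= P m.
  move=> /subnKC <-; apply: le_trans (tail _); rewrite ler_pM2l //.
  by rewrite lerDl divr_ge0.
by apply: (le_trans (low (n + 2 * c)%N _)); [lia | apply: Pdecr; lia].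
Qed.

(** * Convergence of the product and bounds for [D] *)

Lemma D_bounds (R : realType) (k : nat) : (3 <= k)%N ->
  cvgn (D_partial R k) /\ 0 < D R k < 1.
Proof.
case: k => [|[|[|j]]] // _.
pose f (p : nat) : R := if prime p then delta j.+3 p%:R / p%:R ^+ j.+2 else 1.
have DE n : D_partial R j.+3 n = \prod_(0 <= i < n.+1) f i.
  by rewrite /D_partial big_mkcond.
have f2 p : prime p -> 2 <= p%:R :> R.
  by move=> /prime_gt1; rewrite (ler_nat R 2).
have f01 p : 0 < f p <= 1.
  rewrite /f; case: ifP => [pp|_]; last by rewrite ltr01 lexx.
  rewrite divr_gt0 ?delta_gt0 ?prime_gt1 //= ?ltW ?D_factor_lt1 ?f2 //.
  by rewrite exprn_gt0 // ltr0n prime_gt0.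
have fc p : (0 < p)%N -> 1 - (j.+2 * j.+3)%:R / p%:R ^+ 2 <= f p.
  move=> _; rewrite /f natrM; case: ifP => [pp|_]; first by rewrite D_factor_ge ?f2.
  by rewrite gerBl divr_ge0 ?mulr_ge0 ?sqr_ge0.
have [l l0 lP] := prod_bounded_away_from0 R f (j.+2 * j.+3) isT f01 fc.
have decr : nonincreasing_seq (D_partial R j.+3).
  apply/nonincreasing_seqP => n; rewrite !DE big_nat_recr //= ler_piMr //.
    by rewrite (le_trans (ltW l0)).
  by case/andP: (f01 n.+1).
have cv : cvgn (D_partial R j.+3).
  by apply: nonincreasing_is_cvgn => //; exists l => _ [n _ <-]; rewrite DE.
split=> //; apply/andP; split.
  by apply: (lt_le_trans l0); apply: limr_ge => //; apply: nearW => n; rewrite DE.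
(* The limit is at most the partial product up to 2, which is the single factor at p = 2; this keeps
   the upper bound strict. *)
apply: (le_lt_trans (nonincreasing_cvgn_ge decr cv 2%N)).
rewrite DE !big_nat_recr //= big_geq // /f /= !mul1r.
exact: D_factor_lt1.
Qed.

Theorem theorem5 (R : realType) :
  (forall k : nat, (3 <= k)%N ->
     cvgn (D_partial R k) /\ 0 < D R k < 1) /\
  (forall k n : nat, (3 <= k)%N -> (0 < n)%N ->
     1 / (2 * k%:R) < g R k n < 2 * k%:R).
Proof.
split=> [k k3|k n k3 _]; [exact: D_bounds | exact: g_bounds].
Qed.
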